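(* Let $W$ be a finite-dimensional representation of $\mathfrak{su}(2)$, not necessarily irreducible, let $N\ge 4$, and let $V=W^{\otimes N}$. Then for every $w$, there does not exist a perfect tensor in the constant weight subspace $V_{(w)}$ of $V$ with weight $w$.
   Context: Each finite-dimensional representation $W$ of $\mathfrak{su}(2)$ (not necessarily irreducible), of dimension $D$, is equipped with a Hermitian inner product for which its decomposition into irreducibles is orthogonal, and with an orthonormal basis $e_1,\dots,e_D$ of eigenvectors of $H$, with $He_r=\alpha_r e_r$. Here $H,X,Y$ is the standard basis with $[H,X]=2X$, $[H,Y]=-2Y$, $[X,Y]=H$, so weights are integers (twice the spin). $V=\bigotimes_{k=1}^N V_k$ with every $V_k=W$ has the orthonormal basis $e_I=e_{i_1}\otimes\cdots\otimes e_{i_N}$, $I=(i_1,\dots,i_N)\in\{1,\dots,D\}^N$, and $\mathrm{weight}(I)=\alpha_{i_1}+\cdots+\alpha_{i_N}$. The constant weight subspace $V_{(w)}$ is the span of all $e_I$ with $\mathrm{weight}(I)=w$. For $\Lambda\subseteq\{1,\dots,N\}$ with complement $\Lambda^c$, put $V_\Lambda=\bigotimes_{k\in\Lambda}V_k$ and $V_{\Lambda^c}=\bigotimes_{k\notin\Lambda}V_k$. For $\psi\in V$, $\mathrm{Tr}_{V_\Lambda}(\psi\otimes\psi^* )\in\mathrm{End}(V_{\Lambda^c})$ denotes the partial trace over $V_\Lambda$ of the operator $\psi\otimes\psi^*=|\psi\rangle\langle\psi|$. A vector $\psi\in V$ is called a perfect tensor if for every $\Lambda\subseteq\{1,\dots,N\}$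 with $|\Lambda|\ge N/2$ one has $\mathrm{Tr}_{V_\Lambda}(\psi\otimes\psi^* )=c_{|\Lambda|}\cdot\mathbb{I}_{V_{\Lambda^c}}$ for some nonzero constant $c_{|\Lambda|}$.
   Formalization: The representation W is additionally assumed nontrivial (some element of su(2) acts nonzero); if su(2) acts by zero the claim fails, e.g. for dim W = 1 the vector e_1⊗…⊗e_1 is a perfect tensor of weight 0. *)

(* Defs.v *)
From HB Require Import structures.
From mathcomp Require Import all_boot all_order all_algebra.
From mathcomp Require Import reals complex.

Set Implicit Arguments.
Unset Strict Implicit.
Unset Printing Implicit Defensive.

Import Order.TTheory GRing.Theory Num.Theory.
Local Open Scope ring_scope.
Local Open Scope sesquilinear_scope.

Section SU2.
Variable C : numClosedFieldType.

(* The real Lie algebra su(2): traceless anti-Hermitian matrices, with the     *)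
(* commutator as bracket.                                                      *)
Definition su2 (A : 'M[C]_2) : Prop := A ^t* = - A /\ \tr A = 0.

Variable W : vectType C.
Implicit Types (rho : 'M[C]_2 -> 'End(W)) (U : {vspace W}).

(* Only the values of rho on su(2) matter; linearity is over the reals.        *)
Definition su2_rep rho : Prop :=
  (forall (a : C) (A B : 'M[C]_2), a \is Num.real -> su2 A -> su2 B ->
     rho (a *: A + B) = a *: rho A + rho B) /\
  (forall A B : 'M[C]_2, su2 A -> su2 B ->
     rho (A *m B - B *m A) = (rho A \o rho B)%VF - (rho B \o rho A)%VF).

Definition trivial_rep rho : Prop := forall A, su2 A -> rho A = 0.

(* The complex-linear extension of rho to sl(2) = su(2) + i su(2), through the *)
(* decomposition A = (A - A^* )/2 + i (A + A^* )/(2 i).                        *)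
Definition complexify rho (A : 'M[C]_2) : 'End(W) :=
  rho (2^-1 *: (A - A ^t*)) + 'i *: rho ((2 * 'i)^-1 *: (A + A ^t*)).

(* H = diag(1, -1); with X = delta_mx 0 1 and Y = delta_mx 1 0 one has         *)
(* [H, X] = 2 X, [H, Y] = - 2 Y and [X, Y] = H.                                *)
Definition sl2H : 'M[C]_2 := delta_mx 0 0 - delta_mx 1 1.

Definition subrep rho U : Prop :=
  forall A, su2 A -> (rho A @: U <= U)%VS.

Definition irreducible_subrep rho U : Prop :=
  [/\ subrep rho U, U <> 0%VS &
      forall U', subrep rho U' -> (U' <= U)%VS -> U' = 0%VS \/ U' = U].

Definition orthogonal_irr_decomposition rho (form : {dot W for Num.conj}) : Prop :=
  exists m : nat, exists U : 'I_m -> {vspace W},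
    [/\ forall j, irreducible_subrep rho (U j),
        (\sum_j U j)%VS = fullv,
        directv (\sum_j U j)%VS &
        forall j k, j != k -> forall u v, u \in U j -> v \in U k -> form u v = 0].

End SU2.

(* The tensor power of W over the finite set S of sites, W having dimension D  *)
(* and a fixed orthonormal basis e: a vector is the family of its coordinates  *)
(* in the basis of the e_I, for I : S -> 'I_D (see tens and tens_basis below). *)
Notation tpower C D S := {ffun {ffun S -> 'I_D} -> C^o}.

Notation sites L := {k | k \in L}.

Section TensorPower.
Variables (C : numClosedFieldType) (D : nat).

Definition tvec (S : finType) (I : {ffun S -> 'I_D}) : tpower C D S :=
  [ffun I' => (I' == I)%:R].

(* The inner product for which the e_I are orthonormal, antilinear on the left *)
Definition tdot (S : finType) (a b : tpower C D S) : C :=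
  \sum_I (a I)^* * b I.

Definition tens (W : vectType C) (e : D.-tuple W) (S : finType) (v : S -> W) :
    tpower C D S :=
  [ffun I : {ffun S -> 'I_D} => \prod_(k : S) coord e (I k) (v k)].

Definition basis_tens (W : vectType C) (e : D.-tuple W) (S : finType)
    (I : {ffun S -> 'I_D}) : tpower C D S :=
  tens e (fun k => tnth e (I k)).

Lemma tens_basis (W : vectType C) (e : D.-tuple W) (S : finType)
    (I : {ffun S -> 'I_D}) : free e -> basis_tens e I = tvec I.
Proof.
move=> fe; apply/ffunP => J; rewrite !ffunE.
have coE k : coord e (J k) (tnth e (I k)) = (J k == I k)%:R :> C.
  by rewrite (tnth_nth 0) coord_free //; congr (_%:R); rewrite eq_sym.
under eq_bigr do rewrite coE.
have [->|neJI] := eqVneq J I; first by rewrite big1 // => k _; rewrite eqxx.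
have [k neJk] : exists k, J k != I k.
  apply/existsP; apply: contraR neJI => /existsPn JI; apply/eqP/ffunP => k.
  by apply/eqP; rewrite -[_ == _]negbK JI.
by rewrite (bigD1 k) //= (negbTE neJk) mul0r.
Qed.

Variable N : nat.
Implicit Types L : {set 'I_N}.

Definition weight (alpha : 'I_D -> C) (I : {ffun 'I_N -> 'I_D}) : C :=
  \sum_k alpha (I k).

Definition weight_space (W : vectType C) (e : D.-tuple W) (alpha : 'I_D -> C)
    (w : C) : {vspace tpower C D 'I_N} :=
  (\sum_(I : {ffun 'I_N -> 'I_D} | weight alpha I == w) <[basis_tens e I]>)%VS.

Definition restr L (I : {ffun 'I_N -> 'I_D}) : {ffun sites L -> 'I_D} :=
  [ffun k => I (val k)].

(* The identification of V_L (x) V_(~: L) with V, on pure tensors a (x) b.     *)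
Definition tprod L (a : tpower C D (sites L)) (b : tpower C D (sites (~: L))) :
    tpower C D 'I_N :=
  [ffun I => a (restr L I) * b (restr (~: L) I)].

(* |psi><psi| *)
Definition outer_fun (psi phi : tpower C D 'I_N) : tpower C D 'I_N :=
  tdot psi phi *: psi.

Definition outer (psi : tpower C D 'I_N) : 'End(tpower C D 'I_N) :=
  linfun (outer_fun psi).

(* <e_J| Tr_{V_L} T |phi> = sum_K <e_K (x) e_J| T |e_K (x) phi>.               *)
Definition ptrace_fun L (T : 'End(tpower C D 'I_N))
    (phi : tpower C D (sites (~: L))) : tpower C D (sites (~: L)) :=
  \sum_(J : {ffun sites (~: L) -> 'I_D})
    (\sum_(K : {ffun sites L -> 'I_D})
       tdot (tprod (tvec K) (tvec J)) (T (tprod (tvec K) phi))) *: tvec J.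

Definition ptrace L (T : 'End(tpower C D 'I_N)) :
    'End(tpower C D (sites (~: L))) :=
  linfun (ptrace_fun T).

(* linfun is only meaningful on linear functions: both of the above are.       *)
Lemma tdot_linear (S : finType) (a : tpower C D S) : linear (tdot a : _ -> C^o).
Proof.
move=> x u v; rewrite /tdot scaler_sumr -big_split /=.
by apply: eq_bigr => I _; rewrite !ffunE mulrDr; congr (_ + _); apply: mulrCA.
Qed.

HB.instance Definition _ (S : finType) (a : tpower C D S) :=
  GRing.isLinear.Build C (tpower C D S) C^o _ (tdot a) (tdot_linear a).

Lemma tprod_linear L (a : tpower C D (sites L)) : linear (tprod a).
Proof.
by move=> x u v; apply/ffunP => I; rewrite !ffunE mulrDr; congr (_ + _); apply: mulrCA.
Qed.

HB.instance Definition _ L (a : tpower C D (sites L)) :=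
  GRing.isLinear.Build C _ _ _ (tprod a) (tprod_linear a).

Lemma outer_linear psi : linear (outer_fun psi).
Proof.
by move=> x u v; rewrite /outer_fun linearP scalerDl scalerA.
Qed.

HB.instance Definition _ psi :=
  GRing.isLinear.Build C _ _ _ (outer_fun psi) (outer_linear psi).

Lemma ptrace_linear L T : linear (@ptrace_fun L T).
Proof.
move=> x u v; rewrite /ptrace_fun scaler_sumr -big_split /=.
apply: eq_bigr => J _; rewrite scalerA -scalerDl; congr (_ *: _).
by rewrite mulr_sumr -big_split /=; apply: eq_bigr => K _; rewrite !linearP.
Qed.

HB.instance Definition _ L T :=
  GRing.isLinear.Build C _ _ _ (@ptrace_fun L T) (ptrace_linear T).

Lemma outerE psi phi : outer psi phi = tdot psi phi *: psi.
Proof. by rewrite lfunE. Qed.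

Lemma ptraceE L T phi : @ptrace L T phi = ptrace_fun T phi.
Proof. by rewrite lfunE. Qed.

(* The constant may depend on the cardinal of L, but not on L itself.          *)
Definition perfect_tensor (psi : tpower C D 'I_N) : Prop :=
  exists c : nat -> C, forall L, (N <= 2 * #|L|)%N ->
    c #|L| != 0 /\ ptrace L (outer psi) = c #|L| *: \1%VF.

End TensorPower.

(* Main.v *)
(* Since N >= 4, perfection makes the reduced state on any two sites maximally *)
(* mixed, so for the weights |psi_I|^2 the indices I_k are uniform and         *)
(* pairwise independent. But sum_k alpha(I_k) is constant on the support of    *)
(* psi, which forces alpha to be constant: H acts as a scalar, hence commutes  *)
(* with everything, and [H, X] = 2 X, [H, Y] = - 2 Y, [X, Y] = H make the      *)
(* representation trivial.                                                     *)
Require Import Defs.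
From mathcomp Require Import all_boot all_order all_algebra.
From mathcomp Require Import reals complex.
From mathcomp Require Import ring zify.

Set Implicit Arguments.
Unset Strict Implicit.
Unset Printing Implicit Defensive.

Import Order.TTheory GRing.Theory Num.Theory.

Local Open Scope ring_scope.
Local Open Scope sesquilinear_scope.

(** Read |psi_I|^2 as an unnormalized distribution on the indices I. The diagonal of a reduced state
    is a marginal of it ([ptrace_outer_diag]), so perfection makes any two sites jointly uniform
    ([perfect_pair_marginal]). Conditioning on I_k = a then leaves the mean weight of every other
    site unchanged, while the total weight stays w; hence alpha_a does not depend on a
    ([pair_uniform_weight_const]). So H acts as a scalar, and since brackets with H generate the
    other directions of su(2), the representation is trivial ([scalar_weight_trivial]), against the
    assumption. *)

Definition mx22 (T : Type) (a b c d : T) : 'M[T]_2 :=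
  \matrix_(i, j) if i == 0 then if j == 0 then a else b
                 else if j == 0 then c else d.

(** * Explicit 2x2 matrices: matrix identities become scalar ones *)

Section Matrices22.
Variable C : numClosedFieldType.
Implicit Types (a b c d x : C) (A : 'M[C]_2).

Lemma mx22_eta A : A = mx22 (A 0 0) (A 0 1) (A 1 0) (A 1 1).
Proof.
apply/matrixP => i j; rewrite !mxE.
by case: i j => [[|[|//]] Hi] [[|[|//]] Hj] /=; congr (A _ _); apply: val_inj.
Qed.

Lemma mulmx22 a b c d a' b' c' d' :
  mx22 a b c d *m mx22 a' b' c' d' =
  mx22 (a * a' + b * c') (a * b' + b * d') (c * a' + d * c') (c * b' + d * d').
Proof.
by rewrite [LHS]mx22_eta !mxE !big_ord_recl !big_ord0 !mxE /= !addr0.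
Qed.

Lemma addmx22 a b c d a' b' c' d' :
  mx22 a b c d + mx22 a' b' c' d' = mx22 (a + a') (b + b') (c + c') (d + d').
Proof. by rewrite [LHS]mx22_eta !mxE. Qed.

Lemma oppmx22 a b c d : - mx22 a b c d = mx22 (- a) (- b) (- c) (- d).
Proof. by rewrite [LHS]mx22_eta !mxE. Qed.

Lemma scalemx22 x a b c d :
  x *: mx22 a b c d = mx22 (x * a) (x * b) (x * c) (x * d).
Proof. by rewrite [LHS]mx22_eta !mxE. Qed.

Lemma adjmx22 a b c d : (mx22 a b c d)^t* = mx22 a^* c^* b^* d^*.
Proof. by rewrite [LHS]mx22_eta !mxE. Qed.

Lemma su2_mx22 a b c d :
  a^* = - a -> c^* = - b -> b^* = - c -> d = - a -> su2 (mx22 a b c d).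
Proof.
move=> ha hc hb hd; split.
  by rewrite adjmx22 oppmx22 ha hc hb hd rmorphN /= ha.
by rewrite /mxtrace !big_ord_recl big_ord0 !mxE /= hd addr0 subrr.
Qed.

Lemma sl2HE : sl2H C = mx22 1 0 0 (-1).
Proof. by rewrite [LHS]mx22_eta !mxE /= subr0 subrr sub0r. Qed.

End Matrices22.

(** * Representations of su(2) on which H is a scalar *)

Section Su2Representation.
Variables (C : numClosedFieldType) (W : vectType C).
Variable rho : 'M[C]_2 -> 'End(W).
Hypothesis rho_rep : su2_rep rho.

Lemma su2_0 : su2 (0 : 'M[C]_2).
Proof. by split; rewrite ?mxtrace0 // trmx0 map_mx0 oppr0. Qed.

Lemma su2_lin (x : C) (A B : 'M[C]_2) :
  x \is Num.real -> su2 A -> su2 B -> su2 (x *: A + B).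
Proof.
move=> /CrealP xR [Aadj Atr] [Badj Btr]; split; last first.
  by rewrite mxtraceD mxtraceZ Atr Btr mulr0 addr0.
rewrite linearD /= map_mxD Badj linearZ /= map_mxZ /= xR Aadj.
by rewrite scalerN opprD.
Qed.

Lemma su2_rep0 : rho 0 = 0.
Proof.
have := rho_rep.1 (-1) 0 0 (rpredN1 _) su2_0 su2_0.
by rewrite scaler0 addr0 scaleN1r addNr.
Qed.

Lemma su2_repZ x A : x \is Num.real -> su2 A -> rho (x *: A) = x *: rho A.
Proof.
move=> xR Asu; have := rho_rep.1 x A 0 xR Asu su2_0.
by rewrite su2_rep0 !addr0.
Qed.

(* The three skew-Hermitian generators are -i sigma_z, i sigma_y, i sigma_x. *)
Lemma scalar_weight_trivial (a : C) :
  complexify rho (sl2H C) = a *: \1%VF -> trivial_rep rho.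
Proof.
set Z := mx22 (- 'i) 0 0 'i : 'M[C]_2.
set U := mx22 0 1 (-1) 0 : 'M[C]_2.
set V := mx22 0 'i 'i 0 : 'M[C]_2.
have i2 : 'i * 'i = -1 :> C by rewrite -expr2 sqrCi.
have i0 : 'i != 0 :> C := neq0Ci C.
have Zsu : su2 Z.
  by apply: su2_mx22; rewrite ?rmorph0 ?rmorphN /= ?conjCi ?oppr0 ?opprK.
have Usu : su2 U.
  by apply: su2_mx22; rewrite ?rmorph0 ?rmorphN /= ?rmorph1 ?oppr0 ?opprK.
have Vsu : su2 V by apply: su2_mx22; rewrite ?rmorph0 ?conjCi ?oppr0.
(* H is Hermitian, so only the second term of [complexify] survives; it is 'i times [rho] of -iH =
   [Z]. *)
rewrite /complexify sl2HE adjmx22 rmorphN rmorph0 /= rmorph1 subrr scaler0.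
rewrite su2_rep0 add0r addmx22 scalemx22 addr0 mulr0.
have -> : mx22 ((2 * 'i)^-1 * (1 + 1)) 0 0 ((2 * 'i)^-1 * (-1 - 1)) = Z.
  by rewrite /Z; congr mx22; field: (i2).
move=> rZ.
have {rZ} rZ : rho Z = ('i^-1 * a) *: \1%VF.
  by rewrite -scalerA -rZ scalerA mulVf // scale1r.
have commZ A : (rho Z \o rho A)%VF - (rho A \o rho Z)%VF = 0.
  by rewrite rZ -comp_lfunZl -comp_lfunZr comp_lfun1l comp_lfun1r subrr.
have m2 : -2 != 0 :> C by rewrite oppr_eq0 pnatr_eq0.
have rm2 A : su2 A -> rho (-2 *: A) = 0 -> rho A = 0.
  move=> Asu; rewrite su2_repZ // ?rpredN ?realn //.
  by move/eqP; rewrite scaler_eq0 (negbTE m2) => /eqP.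
(* The cyclic brackets [Z, U] = -2V, [V, Z] = -2U, [U, V] = -2Z spread the vanishing: first to [V]
   since [rho Z] is central, then to [U], then to [Z] itself. *)
have rV : rho V = 0.
  apply: rm2 => //; rewrite -(commZ U) -rho_rep.2 //; congr rho.
  by rewrite !mulmx22 oppmx22 addmx22 scalemx22; congr mx22; ring.
have comm0 A B : su2 A -> su2 B -> rho A = 0 -> rho (A *m B - B *m A) = 0.
  by move=> Asu Bsu rA; rewrite rho_rep.2 // rA comp_lfun0l comp_lfun0r subrr.
have rU : rho U = 0.
  apply: rm2 => //; rewrite -(comm0 V Z) //; congr rho.
  by rewrite !mulmx22 oppmx22 addmx22 scalemx22; congr mx22; ring: (i2).
have rZ0 : rho Z = 0.
  apply: rm2 => //; rewrite -(comm0 U V) //; congr rho.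
  by rewrite !mulmx22 oppmx22 addmx22 scalemx22; congr mx22; ring.
move=> A [Aadj Atr].
have A00 : (A 0 0)^* = - A 0 0.
  by have := congr1 (fun B : 'M_2 => B 0 0) Aadj; rewrite !mxE.
have A10 : A 1 0 = - (A 0 1)^*.
  by have := congr1 (fun B : 'M_2 => B 1 0) Aadj; rewrite !mxE => ->; rewrite opprK.
have A11 : A 1 1 = - A 0 0.
  move: Atr; rewrite /mxtrace !big_ord_recl big_ord0 addr0 => /eqP.
  rewrite addrC addr_eq0 => /eqP <-; congr (A _ _); exact: val_inj.
(* The coefficients are real, as [su2_rep] demands: [A 0 0] is purely imaginary. *)
have -> : A = 'Re (A 0 1) *: U + ('Im (A 0 1) *: V + ('i * A 0 0) *: Z).
  rewrite [LHS]mx22_eta A10 A11 !scalemx22 !addmx22 {1}[A 0 1]Crect.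
  have -> : (A 0 1)^* = 'Re (A 0 1) - 'i * 'Im (A 0 1).
    by rewrite {1}[A 0 1]Crect conjC_rect ?Creal_Re ?Creal_Im.
  by congr mx22; ring: (i2).
have tR : 'i * A 0 0 \is Num.real.
  by apply/CrealP; rewrite rmorphM /= conjCi A00 mulrNN.
have ZZsu : su2 (('i * A 0 0) *: Z).
  by rewrite -[X in su2 X]addr0; apply: su2_lin => //; apply: su2_0.
rewrite rho_rep.1 ?Creal_Re //; last by apply: su2_lin; rewrite ?Creal_Im.
rewrite rho_rep.1 ?Creal_Im // su2_repZ //.
by rewrite rU rV rZ0 !scaler0 !addr0.
Qed.

End Su2Representation.

(** * Reduced states as marginals, and their effect on weights *)

Section PerfectTensor.
Variables (C : numClosedFieldType) (D N : nat).
Implicit Types (L : {set 'I_N}) (psi : tpower C D 'I_N).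

Lemma weight_space_supp (W : vectType C) (e : D.-tuple W) (alpha : 'I_D -> C)
    (w : C) psi I :
  free e -> psi \in weight_space N e alpha w -> psi I != 0 ->
  weight alpha I = w.
Proof.
move=> fe /memv_sumP [vs vsP ->]; apply: contraNeq => wI.
rewrite sum_ffunE big1 // => J wJ.
have /vlineP [x ->] := vsP J wJ; rewrite tens_basis // !ffunE.
case: eqVneq => [IJ|_]; last by rewrite scaler0.
by rewrite IJ wJ in wI.
Qed.

Lemma restr_inj L (I I' : {ffun 'I_N -> 'I_D}) :
  (restr L I == restr L I') && (restr (~: L) I == restr (~: L) I') = (I == I').
Proof.
apply/andP/eqP => [[/eqP h /eqP h']|-> //]; apply/ffunP => k.
have [kL|kL] := boolP (k \in L).
  by have := congr1 (fun f : {ffun _ -> 'I_D} => f (Sub k kL)) h; rewrite !ffunE.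
rewrite -in_setC in kL.
by have := congr1 (fun f : {ffun _ -> 'I_D} => f (Sub k kL)) h'; rewrite !ffunE.
Qed.

Lemma tprod_tvecE L (K : {ffun sites L -> 'I_D})
    (J : {ffun sites (~: L) -> 'I_D}) I :
  tprod (tvec C K) (tvec C J) I = ((restr L I == K) && (restr (~: L) I == J))%:R.
Proof. by rewrite !ffunE -natrM mulnb. Qed.

(** The K-th term of the partial trace is |psi_I|^2 for the unique I that restricts to K on L and to
    J off L; summing over K gives the marginal of the sites outside L. *)
Lemma ptrace_outer_diag psi L (J : {ffun sites (~: L) -> 'I_D}) :
  ptrace L (outer psi) (tvec C J) J =
  \sum_(I : {ffun 'I_N -> 'I_D} | restr (~: L) I == J) psi I * (psi I)^*.
Proof.
rewrite ptraceE /ptrace_fun sum_ffunE (bigD1 J) //= !ffunE eqxx.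
rewrite [X in _ + X]big1 ?addr0; last first.
  by move=> J' J'J; rewrite !ffunE eq_sym (negbTE J'J) scaler0.
rewrite -[LHS]/(_ * _) mulr1.
under eq_bigr => K _.
  rewrite outerE /tdot.
  under eq_bigr => I _ do
    rewrite tprod_tvecE conjC_nat ffunE -[X in _ * X]/(_ * _).
  over.
(* For a given I, only K = [restr L I] contributes. *)
rewrite exchange_big [RHS]big_mkcond /=; apply: eq_bigr => I _.
rewrite (bigD1 (restr L I)) //= eqxx /= [X in _ + X]big1 ?addr0; last first.
  by move=> K KI; rewrite eq_sym (negbTE KI) mul0r.
case: eqVneq => [<-|_]; last by rewrite mul0r.
rewrite mul1r mulrC; congr (_ * _); rewrite (bigD1 I) //= tprod_tvecE !eqxx mulr1.
rewrite big1 ?addr0 // => I' I'I.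
by rewrite tprod_tvecE restr_inj (negbTE I'I) mulr0.
Qed.

(** Trace out all sites but k and l: N - 2 >= N/2 because N >= 4. Every diagonal entry of a scalar
    operator is that scalar, and it depends only on the number N - 2 of traced sites, so one q
    serves all pairs. *)
Lemma perfect_pair_marginal psi : (4 <= N)%N -> perfect_tensor psi ->
  exists2 q : C, q != 0 & forall k l a b, k != l ->
    \sum_(I : {ffun 'I_N -> 'I_D} | (I k == a) && (I l == b))
       psi I * (psi I)^* = q.
Proof.
move=> N4 [c cP]; exists (c (N - 2)%N).
  (* Nonvanishing of the constant is asserted through a set L, so one of size N - 2 is exhibited. *)
  have [L cL] : exists L, #|L| = (N - 2)%N.
    have N2 : (N - 2 <= #|'I_N|)%N by rewrite card_ord leq_subr.
    have [s [us ss _]] := card_geqP N2.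
    by exists [set x in s]; rewrite cardsE (card_uniqP us).
  by have [] := cP L; rewrite cL //; lia.
move=> k l a b kl; have lk : l == k = false by rewrite eq_sym (negbTE kl).
pose L := ~: [set k; l].
have cL : #|L| = (N - 2)%N by rewrite cardsCs setCK cards2 kl card_ord.
have [|_ pt] := cP L; first by rewrite cL; lia.
pose I0 : {ffun 'I_N -> 'I_D} := [ffun j => if j == k then a else b].
have := ptrace_outer_diag psi (restr (~: L) I0).
rewrite pt scale_lfunE id_lfunE !ffunE eqxx -[LHS]/(_ * _) mulr1 cL => ->.
apply: eq_bigl => I; apply/andP/eqP => [[/eqP Ik /eqP Il]|h].
  apply/ffunP => -[j /= jkl]; rewrite !ffunE /=; move: jkl; rewrite !inE negbK.
  by case/orP => /eqP ->; rewrite ?eqxx ?lk.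
have hj j (jL : j \in ~: L) : I j = I0 j.
  by have := congr1 (fun f : {ffun _ -> 'I_D} => f (Sub j jL)) h; rewrite !ffunE.
by rewrite !hj ?setCK ?inE ?eqxx ?orbT // !ffunE eqxx lk !eqxx.
Qed.

(* Compute the sum of |psi_I|^2 weight(I) over the I with I_k = a in two ways: *)
(* as w D q, and, site by site, as D q alpha_a + (N - 1) q sum_b alpha_b.       *)
Lemma pair_uniform_weight_const psi (alpha : 'I_D -> C) (w q : C) :
  (1 < N)%N -> q != 0 ->
  (forall k l a b, k != l ->
    \sum_(I : {ffun 'I_N -> 'I_D} | (I k == a) && (I l == b))
       psi I * (psi I)^* = q) ->
  (forall I, psi I != 0 -> weight alpha I = w) ->
  forall a b, alpha a = alpha b.
Proof.
move=> N1 q0 pair supp a b.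
pose k : 'I_N := Ordinal (ltnW N1); pose l : 'I_N := Ordinal N1.
have kl : k != l by [].
pose p (I : {ffun 'I_N -> 'I_D}) := psi I * (psi I)^*.
have split_site (x : 'I_D) j (F : {ffun 'I_N -> 'I_D} -> C) :
    \sum_(I : {ffun 'I_N -> 'I_D} | I k == x) F I =
    \sum_y \sum_(I : {ffun 'I_N -> 'I_D} | (I k == x) && (I j == y)) F I.
  by rewrite (partition_big (fun I : {ffun 'I_N -> 'I_D} => I j) xpredT).
have single x : \sum_(I : {ffun 'I_N -> 'I_D} | I k == x) p I = D%:R * q.
  rewrite (split_site _ l); under eq_bigr do rewrite pair //.
  by rewrite sumr_const card_ord mulr_natl.
(* The right-hand side does not involve [x], and D is nonzero because ['I_D] contains [a]. *)
suff two_ways x : D%:R * q * alpha x =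
    w * (D%:R * q) - \sum_(j < N | j != k) q * \sum_y alpha y.
  have D0 : D%:R != 0 :> C by rewrite pnatr_eq0 -lt0n (leq_trans _ (ltn_ord a)).
  by apply: (mulfI (mulf_neq0 D0 q0)); rewrite !two_ways.
apply/eqP; rewrite eq_sym subr_eq; apply/eqP.
rewrite -[X in w * X](single x) mulr_sumr.
transitivity (\sum_(I : {ffun 'I_N -> 'I_D} | I k == x) p I * weight alpha I).
  apply: eq_bigr => I _; rewrite mulrC /p.
  (* Off the support of psi, where the weight is unconstrained, both sides are 0. *)
  by have [->|/supp ->] := eqVneq (psi I) 0; rewrite ?mul0r.
under eq_bigr do rewrite /weight mulr_sumr.
rewrite exchange_big (bigD1 k) //=; congr (_ + _).
  by rewrite -(single x) mulr_suml; apply: eq_bigr => I /eqP ->.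
apply: eq_bigr => j jk; rewrite (split_site _ j) mulr_sumr.
apply: eq_bigr => y _; rewrite -(pair k j x y) 1?eq_sym // mulr_suml.
by apply: eq_bigr => I /andP [_ /eqP ->].
Qed.

End PerfectTensor.

Theorem theorem9 (R : realType) (W : vectType R[i])
    (rho : 'M[R[i]]_2 -> 'End(W)) (form : {dot W for Num.conj})
    (D : nat) (e : D.-tuple W) (alpha : 'I_D -> R[i]) (N : nat) (w : R[i]) :
  su2_rep rho ->
  ~ trivial_rep rho ->
  orthogonal_irr_decomposition rho form ->
  basis_of fullv e ->
  orthonormal form e ->
  (forall r : 'I_D, complexify rho (sl2H _) (tnth e r) = alpha r *: tnth e r) ->
  (4 <= N)%N ->
  ~ exists2 psi : tpower R[i] D 'I_N,
      psi \in weight_space N e alpha w & perfect_tensor psi.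
Proof.
move=> rho_rep nontriv _ e_basis _ eigen N4 [psi psi_w perf].
have [q q0 pair] := perfect_pair_marginal N4 perf.
have supp I := weight_space_supp (I := I) (basis_free e_basis) psi_w.
have aconst := pair_uniform_weight_const (ltnW (ltnW N4)) q0 pair supp.
have [a aE] : exists a, forall r, alpha r = a.
  (* If D = 0 there are no weights, and any scalar will do. *)
  case: (posnP D) => [D0|D_gt0].
    by exists 0 => r; have := ltn_ord r; rewrite {2}D0.
  by exists (alpha (Ordinal D_gt0)) => r; apply: aconst.
apply: nontriv; apply: (scalar_weight_trivial rho_rep (a := a)).
apply/lfunP => v; rewrite (coord_basis e_basis (memvf v)) !linear_sum.
apply: eq_bigr => r _; rewrite !linearZ /=; congr (_ *: _).
by rewrite -tnth_nth eigen aE scale_lfunE id_lfunE.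
Qed.
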